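(* Let $B$ be a Banach algebra, let $a\in B$ and let $d\in B$ be regular. Let $d^-$ be any inner inverse of $d$ and $p=dd^-$. If there exists $\beta \in \mathbb{R} \setminus \{0\}$ such that $\| p - \beta dap \| < 1$, then $a$ is invertible along $d$ and $$a^{\parallel d} = \beta \sum_{n=0}^\infty (1-\beta da)^n d = \beta \sum_{n=0}^\infty d(1-\beta ad)^n.$$
   Context: Banach algebras are complex and have a unit $1$; series converge in norm. An element $d\in B$ is regular if there is $d^-\in B$ with $d=dd^-d$; such $d^-$ is called an inner inverse of $d$. For $a,d\in B$, $a$ is invertible along $d$ if there exists $b\in B$ such that $bab=b$, $bB=dB$ and $Bb=Bd$. Such $b$ is unique when it exists and is denoted $a^{\parallel d}$. *)

(* Defs.v *)
From HB Require Import structures.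
From mathcomp Require Import all_boot all_order all_algebra.
From mathcomp Require Import all_classical all_reals all_analysis.
From mathcomp Require Export complex.

Set Implicit Arguments.
Unset Strict Implicit.
Unset Printing Implicit Defensive.

Import Order.TTheory GRing.Theory Num.Theory.

Local Open Scope classical_set_scope.
Local Open Scope ring_scope.
Local Open Scope complex_scope.

(* A unital Banach algebra over K is a complete normed module with a
   submultiplicative bilinear product.  Neither `|1| = 1 nor 1 != 0 is required.
   The norm is K-valued: for K = R[i] its values are nonnegative, hence real, and
   "`|x| < 1" is the order of R[i], which on real elements is the order of R.
   This is a record over completeNormedModType and not an HB structure, because
   HB refuses any structure extending both a ring and a normed Z-module that is
   declared after numDomainType (missing join). *)
Record banachAlgType (K : numFieldType) := BanachAlg {
  banach_space : completeNormedModType K;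
  banach_one : banach_space;
  banach_mul : banach_space -> banach_space -> banach_space;
  banach_mulA : associative banach_mul;
  banach_mul1 : left_id banach_one banach_mul;
  banach_mulr1 : right_id banach_one banach_mul;
  banach_mulDl : left_distributive banach_mul +%R;
  banach_mulDr : right_distributive banach_mul +%R;
  banach_scaleAl : forall (k : K) x y,
    k *: banach_mul x y = banach_mul (k *: x) y;
  banach_scaleAr : forall (k : K) x y,
    k *: banach_mul x y = banach_mul x (k *: y);
  banach_normM : forall x y, `|banach_mul x y| <= `|x| * `|y| }.

Definition banach_sort (K : numFieldType) (B : banachAlgType K) : Type :=
  banach_space B.
Coercion banach_sort : banachAlgType >-> Sortclass.

Section BanachAlgInstances.
Context (K : numFieldType) (B : banachAlgType K).

HB.instance Definition _ := CompleteNormedModule.on (banach_sort B).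

HB.instance Definition _ := GRing.Zmodule_isPzRing.Build (banach_sort B)
  (@banach_mulA K B) (@banach_mul1 K B) (@banach_mulr1 K B)
  (@banach_mulDl K B) (@banach_mulDr K B).

(* The algebra structures of ssralg.v (algType and below) require 1 != 0, hence
   lemmas instead of an instance. *)
Lemma banach_scalerAl (k : K) (x y : B) : k *: (x * y) = (k *: x) * y.
Proof. exact: banach_scaleAl. Qed.

Lemma banach_scalerAr (k : K) (x y : B) : k *: (x * y) = x * (k *: y).
Proof. exact: banach_scaleAr. Qed.

Lemma normrM_le (x y : B) : `|x * y| <= `|x| * `|y|.
Proof. exact: banach_normM. Qed.

End BanachAlgInstances.

Section InverseAlong.
Context {B : pzRingType}.
Implicit Types a b d : B.

Definition inner_inverse d dm := d = d * dm * d.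

Definition is_regular d := exists dm, inner_inverse d dm.

(* range (fun x => b * x) is the right ideal bB, range (fun x => x * b) is Bb *)
Definition is_inverse_along a d b :=
  [/\ b * a * b = b,
      range (fun x : B => b * x) = range (fun x : B => d * x)
    & range (fun x : B => x * b) = range (fun x : B => x * d)].

Definition invertible_along a d := exists b, is_inverse_along a d b.

(* 0 is a junk value, taken when a is not invertible along d *)
Definition inverse_along a d : B := xget 0 [set b | is_inverse_along a d b].

Lemma is_inverse_along_inj a d b c :
  is_inverse_along a d b -> is_inverse_along a d c -> b = c.
Proof.
move=> [bab bB Bb] [cac cB Bc].
have [x _ cx] : range (fun x : B => c * x) b.
  by rewrite cB -bB; exists 1; rewrite ?mulr1.
have [y _ yb] : range (fun x : B => x * b) c.
  by rewrite Bb -Bc; exists 1; rewrite ?mul1r.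
have cab_b : c * a * b = b by rewrite -cx mulrA cac.
have cab_c : c * a * b = c by rewrite -yb -!mulrA (mulrA b) bab.
by rewrite -cab_b cab_c.
Qed.

Lemma inverse_alongE a d b : is_inverse_along a d b -> inverse_along a d = b.
Proof.
move=> hb; apply: xget_unique => // c hc.
exact: is_inverse_along_inj hc hb.
Qed.

End InverseAlong.

(* Main.v *)
Require Import Defs.
From mathcomp Require Import all_boot all_order all_algebra.
From mathcomp Require Import all_classical all_reals all_analysis.

Set Implicit Arguments.
Unset Strict Implicit.
Unset Printing Implicit Defensive.

Import Order.TTheory GRing.Theory Num.Theory.

Local Open Scope classical_set_scope.
Local Open Scope ring_scope.
Local Open Scope complex_scope.

(* Put q = 1 - beta da, w = 1 - beta ad and u_n = q^n d = d w^n.  As u_n lies in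
   dB = pB, also u_n = (q p)^n d, where q p = p - beta dap has norm < 1, so the
   series of the u_n converges to some S.  From q S = S - d = S w one gets
   d a b = d = b a d for b = beta S, and multiplying the series by p = d d^- on
   the left and by d^- d on the right gives b = d d^- b = b d^- d; these four
   identities say that b is the inverse of a along d. *)

(** The last two identities give b a b = b a d x = d x = b, and they also put d in Bb and in bB; the
    two factorizations of b give the opposite inclusions. *)
Lemma is_inverse_along_intro {B : pzRingType} (a d b x y : B) :
  b = d * x -> b = y * d -> d * a * b = d -> b * a * d = d ->
  is_inverse_along a d b.
Proof.
move=> bdx byd dab bad; split.
- by rewrite {2}bdx mulrA bad -bdx.
- apply/seteqP; split=> _ [z _ <-].
    by exists (x * z); rewrite // mulrA -bdx.
  by exists (a * d * z); rewrite // !mulrA bad.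
- apply/seteqP; split=> _ [z _ <-].
    by exists (z * y); rewrite // -mulrA -byd.
  by exists (z * d * a); rewrite // -!mulrA (mulrA d) dab.
Qed.

Lemma exprM_intertwine {A : pzRingType} (q d w : A) n :
  q * d = d * w -> q ^+ n * d = d * w ^+ n.
Proof.
move=> qd; elim: n => [|n IHn]; first by rewrite !expr0 mul1r mulr1.
by rewrite exprS -mulrA IHn mulrA qd -mulrA -exprS.
Qed.

Section BanachAlgebra.
Context {K : numFieldType} {B : banachAlgType K}.
Implicit Types (c x y l : B) (u : nat -> B).

Lemma normrXM_le x y n : `|x ^+ n * y| <= `|x| ^+ n * `|y|.
Proof.
elim: n => [|n IHn]; first by rewrite !expr0 !mul1r.
rewrite !exprS -!mulrA; apply: le_trans (normrM_le _ _) _.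
exact: ler_wpM2l.
Qed.

(** Serves to carry limits of series through one-sided multiplication by a constant, with [k] its
    norm, and through the index shift, with [k] equal to 1. *)
Lemma cvg_dist_le u (v : nat -> B) l l' (k : K) : 0 <= k ->
  (forall n, `|l' - v n| <= k * `|l - u n|) ->
  u @ \oo --> l -> v @ \oo --> l'.
Proof.
move=> k0 uv /cvgrPdist_lt ul; apply/cvgrPdist_lt => e e0.
(* Dividing by [k + 1] instead of [k] covers the case [k = 0]. *)
have k1 : 0 < k + 1 by rewrite ltr_wpDl.
have := ul (e / (k + 1)) (divr_gt0 e0 k1); apply: filterS => n.
rewrite ltr_pdivlMr // => une; apply: le_lt_trans (uv n) (le_lt_trans _ une).
by rewrite mulrC ler_wpM2l // lerDl.
Qed.

Lemma cvg_series_mull c u l :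
  series u @ \oo --> l -> series (fun n => c * u n) @ \oo --> c * l.
Proof.
apply: (@cvg_dist_le _ _ _ _ `|c|) => // n.
by rewrite /series /= -mulr_sumr -mulrBr normrM_le.
Qed.

Lemma cvg_series_mulr c u l :
  series u @ \oo --> l -> series (fun n => u n * c) @ \oo --> l * c.
Proof.
apply: (@cvg_dist_le _ _ _ _ `|c|) => // n.
by rewrite /series /= -mulr_suml -mulrBl [leRHS]mulrC normrM_le.
Qed.

Lemma cvg_seriesS u l :
  series u @ \oo --> l -> series (fun n => u n.+1) @ \oo --> l - u 0.
Proof.
rewrite -cvg_shiftS; apply: (@cvg_dist_le _ _ _ _ 1) => // n.
rewrite mul1r /series /= big_nat_recl // opprD addrA.
by rewrite addrAC.
Qed.

Lemma series_lim_uniq u (v : nat -> B) l l' : u =1 v ->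
  series u @ \oo --> l -> series v @ \oo --> l' -> l = l'.
Proof.
move=> /funext -> ul vl'.
by apply: cvg_unique ul vl'; exact: norm_hausdorff.
Qed.

End BanachAlgebra.

(** The norm takes values in [R[i]], so the Cauchy criterion is transferred from the real geometric
    series; a positive [e] in [R[i]] equals its real part. *)
Lemma is_cvg_series_le_geometric (R : realType) (V : completeNormedModType R[i])
    (u : nat -> V) (M r : R) : `|r| < 1 ->
  (forall n, `|u n| <= (M * r ^+ n)%:C) -> cvgn (series u).
Proof.
move=> r1 uM; apply: cauchy_cvg; apply/cauchy_seriesP => e e0.
have eC : (complex.Re e)%:C = e by rewrite RRe_real // gtr0_real.
have e'0 : 0 < complex.Re e by rewrite -ltcR eC.
have /cauchy_cvgP/cauchy_seriesP/(_ _ e'0) :=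
  is_cvg_geometric_series (a := M) r1.
apply: filterS => -[m n] /= Mr; rewrite -eC.
apply: le_lt_trans (ler_norm_sum _ _ _) _.
apply: (@le_lt_trans _ _ (\sum_(m <= k < n) (M * r ^+ k))%:C).
  by rewrite raddf_sum; apply: ler_sum => k _; exact: uM.
by rewrite ltcR; apply: le_lt_trans (ler_norm _) Mr.
Qed.

Lemma is_cvg_series_exprM (R : realType) (B : banachAlgType R[i]) (x y : B) :
  `|x| < 1 -> cvgn (series (fun n => x ^+ n * y)).
Proof.
have normC (z : B) : (complex.Re `|z|)%:C = `|z| by rewrite RRe_real.
move=> x1.
apply: (@is_cvg_series_le_geometric _ _ _
          (complex.Re `|y|) (complex.Re `|x|)).
  have nx0 : 0 <= complex.Re `|x| by rewrite -lecR normC normr_ge0.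
  by rewrite ger0_norm // -ltcR normC.
by move=> n; rewrite rmorphM rmorphXn /= !normC mulrC normrXM_le.
Qed.

Theorem theorem5p8 (R : realType) (B : banachAlgType R[i]) (a d : B)
    (hd : is_regular d) (dm : B) (hdm : inner_inverse d dm)
    (p : B) (hp : p = d * dm)
    (beta : R) (hbeta : beta != 0)
    (hnorm : `|p - beta%:C *: (d * a * p)| < 1) :
  [/\ invertible_along a d,
      cvgn (series (fun n => (1 - beta%:C *: (d * a)) ^+ n * d)),
      inverse_along a d =
        beta%:C *: limn (series (fun n => (1 - beta%:C *: (d * a)) ^+ n * d)),
      cvgn (series (fun n => d * (1 - beta%:C *: (a * d)) ^+ n))
    & inverse_along a d =
        beta%:C *: limn (series (fun n => d * (1 - beta%:C *: (a * d)) ^+ n))].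
Proof.
set c := beta%:C; set q : B := 1 - c *: (d * a); set w : B := 1 - c *: (a * d).
have pd : p * d = d by rewrite hp -hdm.
have qw : q * d = d * w.
  by rewrite mulrBl mulrBr mul1r mulr1 -banach_scalerAl -banach_scalerAr mulrA.
have qwn n : q ^+ n * d = d * w ^+ n by exact: exprM_intertwine.
have wE : (fun n => d * w ^+ n) = (fun n => q ^+ n * d) by apply/funext.
have qp : p - c *: (d * a * p) = q * p.
  by rewrite mulrBl mul1r -banach_scalerAl.
have qpn n : (q * p) ^+ n * d = q ^+ n * d.
  elim: n => [//|n IHn].
  (* By induction the inner factor is d w^n, which p fixes on the left, so q p acts on it as q. *)
  by rewrite exprS -mulrA IHn qwn -!mulrA (mulrA p) pd -qwn mulrA -exprS.
have cvu : cvgn (series (fun n => q ^+ n * d)).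
  rewrite -(funext qpn); apply: is_cvg_series_exprM.
  by rewrite -qp.
set S : B := limn (series (fun n => q ^+ n * d)).
have uS : series (fun n => q ^+ n * d) @ \oo --> S by [].
have pS : p * S = S.
  apply: (series_lim_uniq _ (cvg_series_mull uS) uS) => n.
  by rewrite qwn mulrA pd.
have Sdd : S * (dm * d) = S.
  apply: (series_lim_uniq _ (cvg_series_mulr uS) uS) => n.
  by rewrite -mulrA (mulrA d) -hdm.
have qS : q * S = S - d.
  (* Writing d as [q ^+ 0 * d] exhibits S - d as the sum of the series without its first term; the
     remaining terms are the q u_n. *)
  rewrite -[d]mul1r -(expr0 q).
  apply: (series_lim_uniq _ (cvg_series_mull uS) (cvg_seriesS uS)) => n.
  by rewrite exprS mulrA.
have Sw : S * w = S - d.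
  rewrite -[d]mul1r -(expr0 q).
  apply: (series_lim_uniq _ (cvg_series_mulr uS) (cvg_seriesS uS)) => n.
  by rewrite !qwn exprSr mulrA.
have inv : is_inverse_along a d (c *: S).
  (* The witnesses come from b = p b = d (d^- b) and b = (b d^-) d. *)
  apply: (@is_inverse_along_intro _ _ _ _ (dm * (c *: S)) (c *: S * dm)).
  - by rewrite mulrA -hp -banach_scalerAr pS.
  - by rewrite -mulrA -banach_scalerAl Sdd.
  - rewrite -banach_scalerAr banach_scalerAl.
    (* Expanding q gives S - c d a S = S - d; cancelling S and the sign leaves d a (c S) = d. *)
    by move: qS; rewrite mulrBl mul1r => /addrI/oppr_inj.
  - rewrite -mulrA -banach_scalerAl banach_scalerAr.
    by move: Sw; rewrite mulrBr mulr1 => /addrI/oppr_inj.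
rewrite wE (inverse_alongE inv).
by split=> //; exists (c *: S).
Qed.
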